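(* For natural numbers $c>1$ and $k\ge 1$, there exists an irreducible, torsion free, finitely generated nilpotent group $\Gamma$ of step length $c$ such that $n^k\preceq\mathrm{Conj}_\Gamma(n)$.
   Context: For non-decreasing non-negative functions $f,g$ on $\mathbb{N}=\{1,2,\dots\}$, write $f\preceq g$ if there is $C\in\mathbb{N}$ with $f(n)\le C\,g(Cn)$ for all $n$, and $f\approx g$ if $f\preceq g$ and $g\preceq f$. For a finitely generated group $\Gamma$ with finite generating subset $S$ and word length $\|\cdot\|_S$, write $\gamma\sim\eta$ if $\gamma,\eta$ are conjugate. For $\gamma\nsim\eta$ put $\mathrm{CD}_\Gamma(\gamma,\eta)=\min\{|Q| : \varphi:\Gamma\to Q \text{ a surjective homomorphism to a finite group},\ \varphi(\gamma)\nsim\varphi(\eta)\}$, and $\mathrm{Conj}_{\Gamma,S}(n)=\max\{\mathrm{CD}_\Gamma(\gamma,\eta) : \gamma\nsim\eta,\ \|\gamma\|_S,\|\eta\|_S\le n\}$. Up to $\approx$ this is independent of $S$, and one writes $\mathrm{Conj}_\Gamma$. A group is irreducible if it has no non-trivial splitting as a direct product. The step length of a nilpotent group $\Gamma$ is the minimal $c$ with $\Gamma_{c+1}=\{1\}$, where $\Gamma_1=\Gamma$ and $\Gamma_i=[\Gamma_{i-1},\Gamma]$. *)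

(* Defs.v *)
From mathcomp Require Import all_boot all_fingroup.
From mathcomp Require Import boolp classical_sets functions cardinality.

Set Implicit Arguments.
Unset Strict Implicit.
Unset Printing Implicit Defensive.

Local Open Scope classical_set_scope.
Local Open Scope group_scope.

Section NatSets.
Local Open Scope nat_scope.

Definition is_min (A : set nat) (m : nat) : Prop :=
  A m /\ forall a, A a -> m <= a.

Definition is_max (A : set nat) (m : nat) : Prop :=
  A m /\ forall a, A a -> a <= m.

(* The minimum (maximum) is 0 by convention when it does not exist. *)
Definition set_min (A : set nat) : nat := xget 0 (is_min A).

Definition set_max (A : set nat) : nat := xget 0 (is_max A).

(* Functions on N = {1, 2, ...}: the values at 0 are ignored. *)
Definition growth_le (f g : nat -> nat) : Prop :=
  exists C : nat, 0 < C /\ forall n, 0 < n -> f n <= C * g (C * n).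

End NatSets.

Section Groups.
Variable G : groupType.

Definition subgroup (H : set G) : Prop :=
  [/\ H 1, forall x y, H x -> H y -> H (x * y) & forall x, H x -> H x^-1].

Definition gen (A : set G) : set G := smallest subgroup A.

Definition generates (S : set G) : Prop := gen S = [set: G].

Definition finitely_generated : Prop :=
  exists S : set G, finite_set S /\ generates S.

Definition commutator_subgroup (A B : set G) : set G :=
  gen [set [~ a, b] | a in A & b in B].

(* The indices are shifted by one: lower_central i is the term Gamma_{i+1}
   of the lower central series, which starts at Gamma_1 = G. *)
Fixpoint lower_central (i : nat) : set G :=
  if i is i'.+1 then commutator_subgroup (lower_central i') [set: G]
  else [set: G].

Definition nilpotent : Prop := exists c : nat, lower_central c = [set 1].

Definition has_step_length (c : nat) : Prop :=
  is_min [set i | lower_central i = [set 1]] c.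

Definition torsion_free : Prop :=
  forall (x : G) (n : nat), (0 < n)%N -> x ^+ n = 1 -> x = 1.

Definition irreducible : Prop :=
  forall (A B : groupType) (f : {multiplicative G -> (A * B)%type}),
    bijective f -> (forall a : A, a = 1) \/ (forall b : B, b = 1).

Definition conjugate (x y : G) : Prop := exists z : G, x ^ z = y.

Definition word_over (S : set G) (w : seq G) : Prop :=
  forall x, x \in w -> S x \/ S x^-1.

Definition word_length (S : set G) (x : G) : nat :=
  set_min [set size w | w in [set w | word_over S w /\ \prod_(y <- w) y = x]].

End Groups.

Arguments finitely_generated : clear implicits.
Arguments nilpotent : clear implicits.
Arguments has_step_length : clear implicits.
Arguments torsion_free : clear implicits.
Arguments irreducible : clear implicits.

(* This is 0 when no finite quotient of G separates the conjugacy classes of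
   x and y, which cannot occur in a conjugacy separable group. *)
Definition CD (G : groupType) (x y : G) : nat :=
  set_min [set m | exists (Q : finGroupType) (f : {multiplicative G -> Q}),
    [/\ range f = [set: Q], ~ conjugate (f x) (f y) & #|Q| = m]].

Definition Conj (G : groupType) (S : set G) (n : nat) : nat :=
  set_max [set m | exists x y : G,
    [/\ ~ conjugate x y, (word_length S x <= n)%N, (word_length S y <= n)%N
      & CD x y = m]].

(* Main.v *)
Require Import Defs.
From HB Require Import structures.
From mathcomp Require Import all_boot all_algebra all_fingroup cyclic ring.
From mathcomp Require Import boolp classical_sets functions cardinality.
Import Defs.

(** Let V = Z^k, let V act by translations on the functions from V to Z, and
    let W be the semidirect product of the functions by V, that is the
    unrestricted wreath product of Z by V. The group G used here is the
    subgroup of W generated by the coordinate functions, the unit translations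
    and one polynomial function of degree c - 1, the falling factorial of the
    first coordinate.

    Everything about commutators follows from one formula
    ([wreath_commg]): the commutator of (f, a) and (h, b) is the function
    D_b f - D_a h, where D_a f (v) = f (v + a) - f v. Hence each step down the
    lower central series lowers the degree of the functions by one, so that G
    has step length at most c ([lower_central_deg]), while iterated differences
    of the falling factorial remain nonzero for c - 1 steps
    ([genType_step_length]). It follows too that taking commutators leads from
    any nontrivial element to a nonzero constant function, inside any normal
    subgroup ([normal_const]). The constants form a copy of Z, so two
    nontrivial normal subgroups always meet nontrivially, and G is irreducible
    ([genType_irreducible]). Torsion is absent since Z and V have none.

    For the lower bound on Conj, let z be the constant function 1, let g be the
    first coordinate function, and put N = 2^(j+1), x = g^N, y = x z^(N/2).
    Reduction modulo N kills x and does not kill y, so x and y are separated by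
    a finite quotient ([separating_quotient]); here polynomials with integer
    coefficients matter, as they induce functions on V modulo N. Conversely let
    Q be any finite quotient in which x and y are not conjugate. Conjugation by
    a unit translation multiplies x by z^N, so z^(N/2) is not a power of z^N in
    Q. As N is a power of 2, this forces N to divide the order of z in Q
    ([separated_order]). Now the commutator of the i-th coordinate function and
    of the translation by v is z^(v_i), so translations by vectors that differ
    modulo N have different images in Q, whence |Q| >= N^k
    ([quotient_card_ge]). The lengths of x and y are linear in N, and every n
    lies within a factor 2 of such an N. *)

Set Implicit Arguments.
Unset Strict Implicit.
Unset Printing Implicit Defensive.
Import GRing.Theory Num.Theory.

Local Open Scope classical_set_scope.
Local Open Scope group_scope.

(** * Extrema of sets of natural numbers *)

Section Extrema.
Implicit Type A : set nat.

Lemma set_min_is_min A : A !=set0 -> is_min A (set_min A).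
Proof.
move=> [a Aa]; apply: xgetPex.
have exA : exists n, `[< A n >] by exists a; apply/asboolP.
have [m /asboolP Am minm] := find_ex_minn exA.
by exists m; split=> // b Ab; apply: minm; apply/asboolP.
Qed.

Lemma set_min_mem A : A !=set0 -> A (set_min A).
Proof. by move/set_min_is_min=> []. Qed.

Lemma set_min_le A a : A a -> set_min A <= a.
Proof.
move=> Aa; have [|_] := @set_min_is_min A; first by exists a.
exact.
Qed.

Lemma finite_le_set_max A a : finite_set A -> A a -> a <= set_max A.
Proof.
move=> /finite_seqP[s sE] Aa.
have exA : exists n, `[< A n >] by exists a; apply/asboolP.
have ubA n : `[< A n >] -> n <= \max_(i <- s) i.
  move=> /asboolP; rewrite sE /= => sn.
  by rewrite (big_rem n) //= leq_maxl.
have [m /asboolP Am maxm] := ex_maxnP exA ubA.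
have [|_] := @xgetPex _ 0 (is_max A); last exact.
by exists m; split=> // b Ab; apply: maxm; apply/asboolP.
Qed.

End Extrema.

(** * Generated subgroups and word length *)

Section Generation.
Variable G : groupType.
Implicit Types (A S H : set G) (x y : G).

Lemma gen_subgroup A : subgroup (gen A).
Proof.
split.
- by move=> H [[]].
- by move=> x y Ax Ay H /= HA; case: (HA) => -[_ + _] _; apply; [apply: Ax|apply: Ay].
- by move=> x Ax H /= HA; case: (HA) => -[_ _ +] _; apply; apply: Ax.
Qed.

Lemma gen_base A : A `<=` gen A.
Proof. exact: sub_gen_smallest. Qed.

Lemma gen_least A H : subgroup H -> A `<=` H -> gen A `<=` H.
Proof. exact: smallest_sub. Qed.

Lemma gen_mem1 A : gen A 1.
Proof. by case: (gen_subgroup A). Qed.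

Lemma gen_memM A x y : gen A x -> gen A y -> gen A (x * y).
Proof. by case: (gen_subgroup A) => _ + _; apply. Qed.

Lemma gen_memV A x : gen A x -> gen A x^-1.
Proof. by case: (gen_subgroup A) => _ _; apply. Qed.

Lemma gen_memR A x y : gen A x -> gen A y -> gen A [~ x, y].
Proof.
by move=> Ax Ay; rewrite /commg /conjg; do !(apply: gen_memM || apply: gen_memV).
Qed.

End Generation.

Section Ball.
Variables (G : groupType) (S : set G).
Hypotheses (finS : finite_set S) (genS : generates S).
Implicit Types x y : G.

Let words x := [set size w | w in [set w | word_over S w /\ \prod_(y <- w) y = x]].

(** The products of words over [S] form a subgroup, hence all of [G]; so the
    minimum that defines the word length is attained. *)
Lemma words_nonempty x : words x !=set0.
Proof.
suff [w Sw wx] : exists2 w, word_over S w & \prod_(y <- w) y = x.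
  by exists (size w); exists w.
have: gen S x by rewrite genS.
apply: (@gen_least _ S [set x | exists2 w, word_over S w & \prod_(y <- w) y = x]).
  split=> /=.
  - by exists [::]; rewrite ?big_nil.
  - move=> u v [w Sw <-] [w' Sw' <-]; exists (w ++ w'); last by rewrite big_cat.
    by move=> y; rewrite mem_cat => /orP[/Sw|/Sw'].
  - move=> u [w Sw <-]; exists (rev [seq v^-1 | v <- w]).
      move=> y; rewrite mem_rev => /mapP[v /Sw Sv ->]; rewrite invgK.
      by case: Sv; [right|left].
    elim: (w) => [|a s IHs]; first by rewrite !big_nil invg1.
    by rewrite /= rev_cons -cats1 big_cat big_seq1 big_cons invgM IHs.
move=> y Sy; exists [:: y]; last by rewrite big_seq1.
by move=> z; rewrite inE => /eqP->; left.
Qed.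

Lemma word_length_word x :
  exists w, [/\ word_over S w, \prod_(y <- w) y = x & size w = word_length S x].
Proof. by have [w [Sw wx] sw] := set_min_mem (words_nonempty x); exists w. Qed.

Lemma word_length_le w : word_over S w -> word_length S (\prod_(y <- w) y) <= size w.
Proof. by move=> Sw; apply: set_min_le; exists w. Qed.

Lemma word_lengthM x y : word_length S (x * y) <= word_length S x + word_length S y.
Proof.
have [u [Su <- <-]] := word_length_word x.
have [v [Sv <- <-]] := word_length_word y.
rewrite -big_cat -size_cat; apply: word_length_le => z.
by rewrite mem_cat => /orP[/Su|/Sv].
Qed.

Lemma word_lengthX x n : word_length S (x ^+ n) <= n * word_length S x.
Proof.
elim: n => [|n IHn].
  by have := @word_length_le [::]; rewrite big_nil => ->.
by rewrite expgS mulSn (leq_trans (word_lengthM _ _)) // leq_add2l.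
Qed.

(** Without finiteness of balls the maximum that defines Conj could fail to
    exist, and would then be 0 by convention. *)
Lemma finite_ball n : finite_set [set x | word_length S x <= n].
Proof.
pose T := S `|` [set x^-1 | x in S].
have finT : finite_set T by rewrite finite_setU; split=> //; apply: finite_image.
pose ball i := iter i (fun B => B `|` [set x * y | x in T & y in B]) [set 1].
have finB i : finite_set (ball i).
  elim: i => [|i IHi]; first exact: finite_set1.
  by rewrite /ball iterS finite_setU; split=> //; apply: finite_image2.
apply: sub_finite_set (finB n) => x /= len_x.
have [w [Sw wx sw]] := word_length_word x.
rewrite -{}wx; rewrite -{}sw in len_x.
elim: w n Sw len_x => [|y w IHw] n Sw.
  rewrite big_nil => _; elim: n => [|n IHn] //.
  by rewrite /ball iterS; left.
case: n => // n len_w; rewrite big_cons /ball iterS; right; exists y.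
  case: (Sw y (mem_head _ _)) => [Sy|Sy]; first by left.
  by right; exists y^-1; rewrite ?invgK.
exists (\prod_(z <- w) z) => //; apply: IHw => //.
by move=> z wz; apply: Sw; rewrite inE wz orbT.
Qed.

Lemma CD_le_Conj x y n : ~ conjugate x y ->
  word_length S x <= n -> word_length S y <= n -> CD x y <= Conj S n.
Proof.
move=> nxy xn yn; apply: finite_le_set_max; last by exists x, y.
apply: sub_finite_set (finite_image2 (@CD G) (finite_ball n) (finite_ball n)).
by move=> m [u [v [_ un vn <-]]]; exists u => //; exists v.
Qed.

End Ball.

(** * Finite quotients that separate conjugacy classes *)

Section GroupMorphism.
Variables (G H : groupType) (f : {multiplicative G -> H}).

Lemma multiplicative1 : f 1 = 1.
Proof. by apply: (@mulgI _ (f 1)); rewrite -gmulfM !mulg1. Qed.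

Definition group_morphism : UMagmaMorphism.type G H :=
  HB.pack (f : G -> H) (isMultiplicative.Build G H f (@gmulfM G H f))
    (Multiplicative_isUMagmaMorphism.Build G H f multiplicative1).

Lemma multiplicativeX n : {morph f : x / x ^+ n}.
Proof. exact: (gmulfXn group_morphism). Qed.

Lemma multiplicativeJ : {morph f : x y / x ^ y}.
Proof. exact: (gmulfJ group_morphism). Qed.

Lemma multiplicativeR : {morph f : x y / [~ x, y]}.
Proof. exact: (gmulfR group_morphism). Qed.

End GroupMorphism.

Section Separation.
Variable G : groupType.
Implicit Types x y : G.

(** A quotient that separates [x] from [y] has to be exhibited for the bound
    on the order of all such quotients to say anything, because CD is 0 when
    there is none. It may be given by a morphism [f0] that is not surjective,
    which is then replaced by its corestriction to its image. *)
Lemma CD_ge x y m (Q0 : finGroupType) (f0 : {multiplicative G -> Q0}) :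
    f0 x = 1 -> f0 y != 1 ->
    (forall (Q : finGroupType) (f : {multiplicative G -> Q}),
      ~ conjugate (f x) (f y) -> m <= #|Q|) ->
  m <= CD x y.
Proof.
move=> fx fy lbm; rewrite /CD.
set A := (X in set_min X).
suff /set_min_mem : A !=set0 by move=> [Q [f [_ /lbm + <-]]].
pose H := [set q : Q0 | `[< range f0 q >]]%SET.
have gH : group_set H.
  apply/group_setP; split.
    by rewrite !inE; exists 1; rewrite ?multiplicative1.
  by move=> p q /[!inE] -[a _ <-] [b _ <-]; exists (a * b) => //=; rewrite gmulfM.
pose K := Group gH.
have fK a : f0 a \in K by rewrite !inE; exists a.
pose f a : subg_of K := subg K (f0 a).
have fM : {morph f : a b / a * b}.
  by move=> a b; apply: val_inj; rewrite /= !subgK ?gmulfM ?groupM.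
pose F : {multiplicative G -> subg_of K} := HB.pack f (isMultiplicative.Build _ _ f fM).
exists #|subg_of K|; exists (subg_of K), F; split=> //.
  apply/seteqP; split=> // q _.
  have := subgP q; rewrite !inE => -[a _ aq]; exists a => //.
  by apply: val_inj; rewrite /= /f subgK.
case=> z /=.
rewrite {1}/f fx [subg K 1]morph1 conj1g => /(congr1 val); rewrite /= subgK // => fy1.
by move: fy; rewrite -fy1 eqxx.
Qed.

End Separation.

Section QuotientBound.
Variable Q : finGroupType.
Implicit Types g u z : Q.

(** As [g ^ u = g * z] with [z] fixed by [u], each conjugation by [u] of
    [g ^+ n] contributes a factor [z ^+ n]. *)
Lemma conjX_central g u z s : commute z u -> commute g z ->
  [~ g, u] = z -> forall n, (g ^+ n) ^ (u ^+ s) = g ^+ n * z ^+ (n * s).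
Proof.
move=> zu gz guz n.
have gu : g ^ u = g * z by rewrite -guz commgEl mulVKg.
have zJ : z ^ u = z by rewrite conjgE zu mulKg.
elim: s => [|s IHs]; first by rewrite conjg1 muln0 mulg1.
rewrite expgSr conjgM IHs conjMg !conjXg zJ gu expgMn // -mulgA -expgD.
by rewrite mulnS.
Qed.

(** Otherwise the gcd of [2 ^ j.+1] and of the order of [z] is a smaller power
    of 2, hence divides [2 ^ j]; by Bezout [z ^+ (2 ^ j)] is then a power of
    [z ^+ (2 ^ j.+1)], and a power of [u] conjugates the two elements. *)
Lemma separated_order g u z j : commute z u -> commute g z -> [~ g, u] = z ->
  ~ conjugate (g ^+ (2 ^ j.+1)) (g ^+ (2 ^ j.+1) * z ^+ (2 ^ j)) ->
  (2 ^ j.+1 %| #[z])%N.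
Proof.
move=> zu gz guz nconj; set n := (2 ^ j.+1)%N in nconj *.
apply: contra_notT nconj => ndvd.
have ngcd : (gcdn n #[z] %| 2 ^ j)%N.
  have /(dvdn_pfactor _ _ (isT : prime 2))[i le_i E] := dvdn_gcdl n #[z].
  rewrite E dvdn_exp2l // -ltnS ltn_neqAle le_i andbT.
  apply: contra ndvd => /eqP ij; rewrite /n -ij -E; exact: dvdn_gcdr.
have [a _] := Bezoutl n (order_gt0 z).
rewrite gcdnC => dvd_a; case/dvdnP: ngcd => q Eq.
(* The exponent is - a * q, made nonnegative by adding a multiple of the order. *)
exists (u ^+ (#[z] * (a * q) - a * q)).
rewrite (conjX_central _ zu gz guz); congr (_ * _).
have z1 : z ^+ (2 ^ j + n * (a * q)) = 1.
  have -> : (2 ^ j + n * (a * q) = (gcdn n #[z] + a * n) * q)%N.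
    by rewrite Eq mulnDl mulnCA mulnA [(q * _)%N]mulnC.
  by case/dvdnP: dvd_a => r ->; rewrite mulnAC mulnC expgM expg_order expg1n.
apply: (mulIg (z ^+ (n * (a * q)))).
rewrite -!expgD z1 -mulnDr subnK ?leq_pmull // mulnCA expgM expg_order expg1n //.
Qed.

(** The commutators with the [g i] recover each entry of [v] modulo the order
    of [z], hence exactly, so that [tau] is injective. *)
Lemma quotient_card_ge k n z (g : 'I_k -> Q) (tau : {ffun 'I_k -> 'I_n} -> Q) :
    (forall i v, [~ g i, tau v] = z ^+ v i) -> (n %| #[z])%N ->
  (n ^ k <= #|Q|)%N.
Proof.
move=> gtau ndvd.
have tau_inj : injective tau.
  move=> v w tvw; apply/ffunP => i; apply: val_inj => /=.
  have /eqP : z ^+ v i = z ^+ w i by rewrite -!gtau tvw.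
  rewrite eq_expg_mod_order => /eqP vw.
  rewrite -(modn_small (ltn_ord (v i))) -(modn_small (ltn_ord (w i))).
  by rewrite -(modn_dvdm _ ndvd) vw modn_dvdm.
by have := leq_card tau tau_inj; rewrite card_ffun !card_ord.
Qed.

End QuotientBound.

(** * The unrestricted wreath product of Z by an abelian group *)

Section Wreath.
Variable V : zmodType.

Definition wreath : Type := ((V -> int) * V)%type.
HB.instance Definition _ := Choice.on wreath.

Implicit Types (f h : V -> int) (a b : V) (x y w : wreath).
Local Open Scope ring_scope.

Definition fdiff a f : V -> int := fun v => f (v + a) - f v.

(** The pair [(f, a)] is the product of the translation by [a] and of the
    function [f], in this order; the order is chosen such that conjugation by a
    translation shifts the argument of a function. *)
Definition wreath_mul x y : wreath := (fun v => x.1 (v + y.2) + y.1 v, x.2 + y.2).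
Definition wreath_one : wreath := (fun=> 0, 0).
Definition wreath_inv x : wreath := (fun v => - x.1 (v - x.2), - x.2).

Lemma wreath_eq x y : x.1 =1 y.1 -> x.2 = y.2 -> x = y.
Proof. by case: x y => [f a] [h b] /= /funext-> ->. Qed.

Lemma wreath_mulA : associative wreath_mul.
Proof.
move=> x y w; apply: wreath_eq => [v|] /=; last by rewrite addrA.
by rewrite addrA [y.2 + _]addrC addrA.
Qed.

Lemma wreath_mul1g : left_id wreath_one wreath_mul.
Proof. by move=> x; apply: wreath_eq => [v|] /=; rewrite add0r. Qed.

Lemma wreath_mulg1 : right_id wreath_one wreath_mul.
Proof. by move=> x; apply: wreath_eq => [v|] /=; rewrite !addr0. Qed.

Lemma wreath_mulVg : left_inverse wreath_one wreath_inv wreath_mul.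
Proof. by move=> x; apply: wreath_eq => [v|] /=; rewrite ?addrK addNr. Qed.

Lemma wreath_mulgV : right_inverse wreath_one wreath_inv wreath_mul.
Proof. by move=> x; apply: wreath_eq => [v|] /=; rewrite addrN. Qed.

HB.instance Definition _ := isGroup.Build wreath
  wreath_mulA wreath_mul1g wreath_mulg1 wreath_mulVg wreath_mulgV.

Definition wfun f : wreath := (f, 0).
Definition wtrans a : wreath := (fun=> 0, a).

Lemma wreath_commg x y : [~ x, y]%g = wfun (fun v => fdiff y.2 x.1 v - fdiff x.2 y.1 v).
Proof.
apply: wreath_eq => [v|] /=; rewrite /fdiff.
  have -> : v + (- y.2 + (x.2 + y.2)) - x.2 = v by rewrite [- y.2 + _]addrC !addrK.
  have -> : v + (x.2 + y.2) - y.2 = v + x.2 by rewrite addrA addrK.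
  ring.
by rewrite [X in _ + X]addrC addrK addNr.
Qed.

End Wreath.

(** * The subgroup generated by a set, as a group *)

Section GeneratedSubgroup.
Variables (W : groupType) (A : set W).

Definition in_gen : pred W := fun w => `[< gen A w >].

Record genType := GenType { genval :> W; _ : in_gen genval }.
HB.instance Definition _ := [isSub for genval].
HB.instance Definition _ := [Choice of genType by <:].

Lemma in_gen_group_closed : group_closed in_gen.
Proof.
have mem w : (w \in in_gen) = `[< gen A w >] by [].
split=> [|x y]; rewrite !mem.
  by apply/asboolP; apply: gen_mem1.
by move=> /asboolP Ax /asboolP Ay; apply/asboolP; apply: gen_memM => //; apply: gen_memV.
Qed.

HB.instance Definition _ := SubChoice_isSubGroup.Build W in_gen genType in_gen_group_closed.

Lemma genvalP (x : genType) : gen A x.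
Proof. exact/asboolP/(valP x). Qed.

Definition mkgen w (Aw : gen A w) : genType := GenType (asboolT Aw).

Lemma genvalM : {morph genval : x y / x * y}. Proof. exact: valM. Qed.

Definition genval_mul : {multiplicative genType -> W} :=
  HB.pack genval (isMultiplicative.Build _ _ genval genvalM).

Lemma genvalR : {morph genval : x y / [~ x, y]}.
Proof. exact: (multiplicativeR genval_mul). Qed.

Lemma genvalX n : {morph genval : x / x ^+ n}.
Proof. exact: (multiplicativeX genval_mul). Qed.

Lemma genval1 : genval 1 = 1.
Proof. exact: (multiplicative1 genval_mul). Qed.

Lemma genval_inj : injective genval. Proof. exact: val_inj. Qed.

(** The generators give a generating set of the subtype and not only of the
    subgroup: being the value of an element generated inside the subtype is a
    property closed under the group operations of [W]. *)
Lemma genType_generates : generates (genval @^-1` A).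
Proof.
apply/seteqP; split=> // x _.
suff [y /val_inj<-] : exists2 y : genType, val y = val x & gen (genval @^-1` A) y by [].
apply: (@gen_least _ A [set w | exists2 y : genType, val y = w & gen (genval @^-1` A) y]);
  last exact: genvalP.
  split=> /=.
  - by exists 1; [exact: genval1|exact: gen_mem1].
  - by move=> u v [y <- Ay] [z <- Az]; exists (y * z); [exact: genvalM|exact: gen_memM].
  - move=> u [y <- Ay]; exists y^-1; last exact: gen_memV.
    by apply: (@mulgI _ (val y)); rewrite -[LHS]genvalM !mulgV genval1.
by move=> w Aw; exists (mkgen (gen_base Aw)) => //; apply: gen_base.
Qed.

Lemma genType_fg : finite_set A -> finitely_generated genType.
Proof.
move=> finA; exists (genval @^-1` A); split; last exact: genType_generates.
by apply: finite_preimage => // x y _ _; apply: val_inj.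
Qed.

End GeneratedSubgroup.

(** * Functions of bounded degree *)

Section WreathTheory.
Variable V : zmodType.
Implicit Types (f h : V -> int) (a b : V) (x y : wreath V).
Local Open Scope ring_scope.

Lemma wfunX f n : (wfun f ^+ n)%g = wfun (fun v => f v *+ n).
Proof.
elim: n => [|n IHn]; first exact: wreath_eq.
by rewrite expgS IHn; apply: wreath_eq => [v|] /=; rewrite ?addr0 // mulrS.
Qed.

Lemma wfunM f h : (wfun f * wfun h)%g = wfun (fun v => f v + h v).
Proof. by apply: wreath_eq => [v|] /=; rewrite addr0. Qed.

Lemma wfunV f : ((wfun f)^-1)%g = wfun (fun v => - f v).
Proof. by apply: wreath_eq => [v|] /=; rewrite ?subr0 // oppr0. Qed.

Lemma wtransM a b : (wtrans a * wtrans b)%g = wtrans (a + b).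
Proof. by apply: wreath_eq => [v|] /=; rewrite ?addr0. Qed.

Lemma wtransV a : ((wtrans a)^-1)%g = wtrans (- a).
Proof. by apply: wreath_eq => [v|] /=; rewrite ?oppr0. Qed.

Lemma commg_wtrans x a : x.2 = 0 -> [~ x, wtrans a]%g = wfun (fdiff a x.1).
Proof.
move=> x0; rewrite wreath_commg; apply: wreath_eq => //= v.
by rewrite /fdiff subrr subr0.
Qed.

Lemma commg_wfun x f : [~ x, wfun f]%g = wfun (fun v => - fdiff x.2 f v).
Proof.
by rewrite wreath_commg; apply: wreath_eq => //= v; rewrite {1}/fdiff addr0 subrr sub0r.
Qed.

Lemma wreathX_snd x n : ((x ^+ n)%g).2 = x.2 *+ n.
Proof. by elim: n => [|n IHn] //; rewrite expgS /= IHn mulrS. Qed.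

(** A torsion element has no translation part, and is then a torsion element
    of the group of functions. *)
Lemma wreath_torsion_free :
  (forall a n, (0 < n)%N -> a *+ n = 0 -> a = 0) -> torsion_free (wreath V).
Proof.
move=> Vtf [f a] n n_gt0 xn1.
have a0 : a = 0 by apply: (Vtf _ _ n_gt0); rewrite -(wreathX_snd (f, a)) xn1.
rewrite a0 in xn1 *; apply: wreath_eq => //= v.
have := congr1 (fun x : wreath V => x.1 v) xn1.
rewrite -[X in (X ^+ n)%g]/(wfun f) wfunX /= => /eqP.
by rewrite mulrn_eq0 => /orP[/eqP n0|/eqP//]; rewrite n0 in n_gt0.
Qed.

Lemma fdiff_additive (l : {additive V -> int}) a v : fdiff a l v = l a.
Proof. by rewrite /fdiff [l (v + a)]raddfD addrC addKr. Qed.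

(** Polynomial functions of degree less than [d], characterised by their
    differences: this is what commutators with translations see, and it makes
    sense over any abelian group. *)
Fixpoint deg_lt d f : Prop :=
  if d is d'.+1 then forall a, deg_lt d' (fdiff a f) else f =1 fun=> 0.

Lemma deg_lt0 d : deg_lt d (fun=> 0).
Proof.
elim: d => [|d IHd] //= a; have := IHd; congr deg_lt.
Qed.

Lemma deg_ltD d f h : deg_lt d f -> deg_lt d h -> deg_lt d (fun v => f v + h v).
Proof.
elim: d f h => [|d IHd] f h /= df dh; first by move=> v; rewrite df dh addr0.
move=> a; have := IHd _ _ (df a) (dh a); congr deg_lt.
by apply/funext => v; rewrite /fdiff opprD addrACA.
Qed.

Lemma deg_ltMz d f (m : int) : deg_lt d f -> deg_lt d (fun v => m * f v).
Proof.
elim: d f => [|d IHd] f /= df; first by move=> v; rewrite df mulr0.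
move=> a; have := IHd _ (df a); congr deg_lt.
by apply/funext => v; rewrite /fdiff mulrBr.
Qed.

Lemma deg_ltN d f : deg_lt d f -> deg_lt d (fun v => - f v).
Proof.
by move=> /(deg_ltMz (-1)); congr deg_lt; apply/funext => v; rewrite mulN1r.
Qed.

Lemma deg_lt_shift d f b : deg_lt d f -> deg_lt d (fun v => f (v + b)).
Proof.
elim: d f => [|d IHd] f /= df; first by move=> v; rewrite df.
move=> a; have := IHd _ (df a); congr deg_lt.
by apply/funext => v; rewrite /fdiff addrAC.
Qed.

Lemma deg_ltS d f : deg_lt d f -> deg_lt d.+1 f.
Proof.
elim: d f => [|d IHd] f /= df a; last exact: (IHd _ (df a)).
by move=> v; rewrite /fdiff !df subrr.
Qed.

Lemma deg_lt_fdiff d f a : deg_lt d f -> deg_lt d.-1 (fdiff a f).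
Proof. by case: d => [|d] //= df v; rewrite /fdiff !df subrr. Qed.

(** By the product rule, the difference of [(l + s) * f] along [a] is the sum of
    [(l + s) * fdiff a f] and of [l a] times a shift of [f]; induct on [d]. *)
Lemma deg_lt_additiveM d f (l : {additive V -> int}) (s : int) :
  deg_lt d f -> deg_lt d.+1 (fun v => (l v + s) * f v).
Proof.
elim: d f => [|d IHd] f df a; first by move=> v; rewrite /fdiff !df !mulr0 subrr.
have := deg_ltD (IHd _ (df a)) (deg_ltMz (l a) (deg_lt_shift a df)); congr deg_lt.
by apply/funext => v; rewrite /fdiff raddfD /=; ring.
Qed.

End WreathTheory.

Arguments deg_lt {V}.

(** * Subgroups of functions of bounded degree: nilpotency and irreducibility *)

Section TranslationGroup.
Variables (V : zmodType) (A : set (wreath V)) (c : nat).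
Hypothesis deg_A : forall x, A x -> deg_lt c x.1.
Let G : groupType := genType A.

Lemma gen_deg_lt (x : G) : deg_lt c (genval x).1.
Proof.
apply: (@gen_least _ A [set x : wreath V | deg_lt c x.1] _ deg_A); last exact: genvalP.
split=> /=.
- exact: deg_lt0.
- by move=> y z dy dz; apply: deg_ltD => //; apply: deg_lt_shift.
- by move=> y dy; apply: deg_ltN; apply: deg_lt_shift.
Qed.

(** Commutators have no translation part, and by [wreath_commg] every function
    part is a difference. The first step, where translation parts are still
    present, needs the degree bound for both arguments. *)
Lemma lower_central_deg_lt i (x : G) : lower_central i x ->
  deg_lt (c - i) (genval x).1 /\ ((0 < i)%N -> (genval x).2 = 0%R).
Proof.
elim: i x => [|i IHi] x; first by rewrite subn0; split=> //; apply: gen_deg_lt.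
pose H := [set x : G | deg_lt (c - i.+1) (genval x).1 /\ (genval x).2 = 0%R].
suff: gen [set [~ a, b] | a in @lower_central G i & b in [set: G]] `<=` H by move=> /[apply] -[].
apply: gen_least => [|_ [y /IHi[dy y0] [z _ <-]]].
  split.
  - by split=> //=; exact: deg_lt0.
  - move=> y z [dy y0] [dz z0]; rewrite /H /= y0 z0 addr0; split=> //.
    by apply: deg_ltD => //; have := deg_lt_shift 0 dy.
  - move=> y [dy y0]; rewrite /H /= y0 oppr0.
    by split=> //; apply: deg_ltN; have := deg_lt_shift 0 dy.
rewrite /H mksetE genvalR wreath_commg; split=> //; apply: deg_ltD.
  by rewrite subnS; apply: deg_lt_fdiff.
apply: deg_ltN; case: (posnP i) => [->|/y0 ->].
  by rewrite subn1; apply: deg_lt_fdiff; apply: gen_deg_lt.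
by have := @deg_lt0 V (c - i.+1); congr deg_lt; apply/funext => v; rewrite /fdiff addr0 subrr.
Qed.

Lemma lower_central_deg : (0 < c)%N -> @lower_central G c = [set 1].
Proof.
move=> c_gt0; apply/seteqP; split=> [x /lower_central_deg_lt|_ ->].
  rewrite subnn => -[fx /(_ c_gt0) ax]; apply: genval_inj.
  by apply: wreath_eq => [v|]; rewrite ?fx ?ax.
by case: (c) => [|d] //; apply: gen_mem1.
Qed.

Lemma genType_nilpotent : (0 < c)%N -> nilpotent G.
Proof. by move=> c_gt0; exists c; apply: lower_central_deg. Qed.

Lemma lower_central_iter_fdiff a f i : gen A (wtrans a) -> gen A (wfun f) ->
  exists2 x : G, lower_central i x & genval x = wfun (iter i (fdiff a) f).
Proof.
move=> Aa Af; elim: i => [|i [x lx xE]]; first by exists (mkgen Af).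
exists [~ x, mkgen Aa : G]; last by rewrite genvalR xE commg_wtrans.
by apply: gen_base; exists x => //; exists (mkgen Aa).
Qed.

(** If some earlier term of the series were trivial, an iterated difference of
    [f], and with it all later ones, would vanish. *)
Lemma genType_step_length a f : (0 < c)%N -> gen A (wtrans a) -> gen A (wfun f) ->
  (exists v, iter c.-1 (fdiff a) f v <> 0%R) -> has_step_length G c.
Proof.
move=> c_gt0 Aa Af [v0 fv0]; split=> [|i /= li1]; first exact: lower_central_deg.
rewrite leqNgt; apply/negP => lt_ic; apply: fv0.
have [x] := lower_central_iter_fdiff i Aa Af.
rewrite li1 => -> /= /(congr1 (fun x : wreath V => x.1)) /= f0.
rewrite -(subnK (_ : i <= c.-1)%N); last by rewrite -ltnS prednK.
rewrite iterD -f0; elim: (c.-1 - i)%N v0 => [|d IHd] v //.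
by rewrite iterS /fdiff !IHd subrr.
Qed.

Section Irreducible.
Variables (I : finType) (l : I -> {additive V -> int}).
Hypotheses (A_tr : forall a, gen A (wtrans a)) (A_l : forall i, gen A (wfun (l i))).
Hypothesis l_sep : forall a, (forall i, l i a = 0%R) -> a = 0%R.

(** If [x] has a translation part [a], its commutator with an [l i] such that
    [l i a] is nonzero is a nonzero constant. If [x] is a function, it is
    constant, or some commutator with a translation is nontrivial and has
    smaller degree. *)
Lemma normal_const (N : set G) : subgroup N ->
    (forall x y, N x -> N [~ x, y]) -> forall x, N x -> x <> 1 ->
  exists p : nat, exists2 w, N w & genval w = wfun (fun=> Posz p.+1).
Proof.
move=> [_ _ NV] NR.
suff Nint x : N x -> x <> 1 ->
    exists m : int, exists2 w, N w & m <> 0%R /\ genval w = wfun (fun=> m).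
  move=> x Nx /(Nint _ Nx)[m [w Nw [m0 wE]]].
  case: m => [[|p]|p] // in m0 wE; first by exists p, w.
  exists p, w^-1; first exact: NV.
  by rewrite -[LHS]/(genval w)^-1%g wE wfunV.
move=> Nx x1; have [x0|nx0] := pselect (forall i, l i (genval x).2 = 0%R); last first.
  have [i li] : exists i, l i (genval x).2 <> 0%R by apply/existsNP.
  exists (- l i (genval x).2)%R; exists [~ x, mkgen (A_l i) : G]; first exact: NR.
  split; first by move/eqP; rewrite oppr_eq0 => /eqP.
  rewrite genvalR commg_wfun; congr wfun; apply/funext => v.
  by rewrite fdiff_additive.
have {}x0 := l_sep x0.
have := gen_deg_lt x; elim: (c) x Nx x1 x0 => [|d IHd] x Nx x1 x0 dx.
  by case: x1; apply: genval_inj; apply: wreath_eq => [v|]; rewrite ?dx ?x0.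
have [xa|nxa] := pselect (forall a, fdiff a (genval x).1 =1 fun=> 0%R); last first.
  have [a xa] : exists a, ~ fdiff a (genval x).1 =1 fun=> 0%R by apply/existsNP.
  have xaE : genval [~ x, mkgen (A_tr a) : G] = wfun (fdiff a (genval x).1).
    by rewrite genvalR commg_wtrans.
  apply: (IHd [~ x, mkgen (A_tr a) : G]); rewrite ?xaE //; [exact: NR| |exact: dx].
  move=> y1; apply: xa => v; move: xaE; rewrite y1.
  by move=> /(congr1 (fun x : wreath V => x.1 v)) /= <-.
have xc v : (genval x).1 v = (genval x).1 0%R.
  by have /eqP := xa v 0%R; rewrite /fdiff add0r subr_eq0 => /eqP.
exists ((genval x).1 0%R), x => //; split; last exact: wreath_eq.
by move=> f0; case: x1; apply: genval_inj; apply: wreath_eq => [v|]; rewrite ?xc ?f0 ?x0.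
Qed.

(** The kernels of the two projections of a nontrivial direct decomposition
    would be nontrivial normal subgroups. Both contain nonzero constants, hence
    so does their intersection, which is trivial. *)
Lemma genType_irreducible : irreducible G.
Proof.
move=> P Q F [F' FK F'K]; apply: contrapT => /not_orP[/existsNP[p p1] /existsNP[q q1]].
have kernel_const (K : groupType) (f : {multiplicative G -> K}) x :
    f x = 1 -> x <> 1 ->
    exists p : nat, exists2 w, f w = 1 & genval w = wfun (fun=> Posz p.+1).
  move=> fx; apply: (@normal_const [set w | f w = 1]) => //.
    split=> /= [|u w fu fw|u fu]; first exact: multiplicative1.
      by rewrite gmulfM fu fw mulg1.
    by rewrite (gmulfV (group_morphism f)) /= fu invg1.
  by move=> u w /= fu; rewrite multiplicativeR fu comm1g.
pose F1 x := (F x).1; pose F2 x := (F x).2.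
have F1M : {morph F1 : x y / x * y} by move=> x y; rewrite /F1 gmulfM.
have F2M : {morph F2 : x y / x * y} by move=> x y; rewrite /F2 gmulfM.
pose M1 : {multiplicative G -> P} := HB.pack F1 (isMultiplicative.Build _ _ F1 F1M).
pose M2 : {multiplicative G -> Q} := HB.pack F2 (isMultiplicative.Build _ _ F2 F2M).
have F'1 y : F' y = 1 -> y = 1 by move=> /(congr1 F); rewrite F'K multiplicative1.
have [||r [u Mu uE]] := kernel_const _ M2 (F' (p, 1)).
- by rewrite /= /F2 F'K.
- by move=> /F'1 [].
have [||s [w Mw wE]] := kernel_const _ M1 (F' (1, q)).
- by rewrite /= /F1 F'K.
- by move=> /F'1 [].
(* Both sides are the constant function with value (r + 1)(s + 1). *)
have uw : u ^+ s.+1 = w ^+ r.+1.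
  apply: genval_inj; rewrite !genvalX uE wE !wfunX; congr wfun; apply/funext => v.
  by rewrite -[LHS]mulr_natr -[RHS]mulr_natr !natz mulrC.
have F1u : M1 (u ^+ s.+1) = 1 by rewrite uw multiplicativeX Mw expg1n.
have F2u : M2 (u ^+ s.+1) = 1 by rewrite multiplicativeX Mu expg1n.
have u1 : u ^+ s.+1 = 1.
  rewrite -[LHS]FK -[RHS]FK multiplicative1; congr F'.
  by rewrite [LHS]surjective_pairing; congr pair.
have := congr1 (fun x : G => (genval x).1 0%R) u1.
by rewrite genvalX uE wfunX /= => /eqP; rewrite mulrn_eq0.
Qed.

End Irreducible.
End TranslationGroup.

(** * Finite quotients by reduction of points and values *)

Section FiniteQuotient.
Variables (V : zmodType) (A : set (wreath V)).
Variables (U : finZmodType) (R : finNzRingType) (red : {additive V -> U}) (lift : U -> V).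
Hypothesis liftK : cancel lift red.
Let G : groupType := genType A.
Local Open Scope ring_scope.

(** Compatibility says that [x.1] induces a function from [U] to [R]. *)
Definition red_compatible (x : wreath V) :=
  forall v v', red v = red v' -> (x.1 v)%:~R = (x.1 v')%:~R :> R.
Hypothesis red_A : forall x, A x -> red_compatible x.

Lemma gen_red_compatible (x : G) : red_compatible (genval x).
Proof.
apply: (@gen_least _ A [set x | red_compatible x] _ red_A); last exact: genvalP.
split=> /=.
- by [].
- move=> y z ry rz v v' vv' /=; rewrite !intrD (rz _ _ vv'); congr (_ + _).
  by apply: ry; rewrite !raddfD vv'.
- move=> y ry v v' vv' /=; rewrite !intrN; congr (- _).
  by apply: ry; rewrite [LHS]raddfB [RHS]raddfB vv'.
Qed.

(** The reduction of [(f, a)] acts on the finite set of pairs of a reduced point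
    and a reduced value by translating the point by [- a] and adding to the
    value that of [f] at the new point. Taking a group of permutations of this
    finite set as target gives a finite group at once. *)
Definition red_act (x : wreath V) (p : U * R) : U * R :=
  (p.1 - red x.2, p.2 + (x.1 (lift (p.1 - red x.2)))%:~R).

Lemma red_actM (x y : G) p :
  red_act (genval (x * y)%g) p = red_act (genval y) (red_act (genval x) p).
Proof.
rewrite /red_act genvalM /= [red (_ + _)]raddfD opprD addrA; congr pair.
rewrite intrD addrA; congr (_ + _ + _); apply: gen_red_compatible.
by rewrite raddfD !liftK subrK.
Qed.

Lemma red_act1 p : red_act 1%g p = p.
Proof. by case: p => u r; rewrite /red_act /= raddf0 subr0 addr0. Qed.

Lemma red_act_inj (x : G) : injective (red_act (genval x)).
Proof.
apply: (@can_inj _ _ _ (red_act (genval (x^-1)%g))) => p.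
by rewrite -red_actM mulgV genval1 red_act1.
Qed.

Definition red_perm (x : G) : {perm U * R} := perm (@red_act_inj x).

Lemma red_permM : {morph red_perm : x y / (x * y)%g}.
Proof. by move=> x y; apply/permP => p; rewrite permM !permE red_actM. Qed.

Lemma finite_quotient : exists (Q : finGroupType) (f : {multiplicative G -> Q}),
  forall (x : G), (genval x).2 = 0 ->
    f x = 1%g <-> forall u, ((genval x).1 (lift u))%:~R = 0 :> R.
Proof.
pose F : {multiplicative G -> {perm U * R}} :=
  HB.pack red_perm (isMultiplicative.Build _ _ red_perm red_permM).
exists {perm U * R}, F => x x0; split=> [fx u|fx].
  have := congr1 (fun s : {perm U * R} => (s (u, 0)).2) fx.
  by rewrite permE perm1 /= x0 raddf0 subr0 add0r.
apply/permP => p; rewrite permE perm1 /red_act x0 raddf0 subr0 fx addr0.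
by case: p.
Qed.

End FiniteQuotient.

(** * The group and its conjugacy separability function *)

Section Construction.
Variables (c k : nat).
Hypothesis c_gt1 : (1 < c)%N.
Let V : zmodType := 'rV[int]_k.+1.
Local Open Scope ring_scope.

Definition coordf (i : 'I_k.+1) (v : 'rV[int]_k.+1) : int := v 0 i.

Lemma coordfB i : {morph coordf i : v w / v - w}.
Proof. by move=> v w; rewrite /coordf !mxE. Qed.

HB.instance Definition _ i := GRing.isZmodMorphism.Build 'rV[int]_k.+1 int (coordf i) (@coordfB i).

(** The falling factorial t (t - 1) ... (t - d + 1) of the first coordinate t.
    The monomial of the same degree is less convenient, since the difference of
    a falling factorial is again a multiple of one; binomial coefficients would
    not be compatible with reduction modulo an integer. *)
Fixpoint fall d (v : 'rV[int]_k.+1) : int :=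
  if d is d'.+1 then (coordf 0 v + - Posz d') * fall d' v else 1.

Lemma fdiff_fall d v : fdiff (delta_mx 0 0) (fall d.+1) v = (Posz d.+1) * fall d v.
Proof.
have fallS w : fall d.+1 (w + delta_mx 0 0) = (coordf 0 w + 1) * fall d w.
  elim: d => [|d IHd]; first by rewrite /= /coordf !mxE eqxx /=; ring.
  rewrite [LHS]/= -/(fall d.+1 _) IHd [fall d.+1 w]/= {1}/coordf !mxE eqxx /=.
  rewrite -/(coordf 0 w) -[d.+1%N]addn1 PoszD.
  ring.
rewrite /fdiff fallS /= -[d.+1%N]addn1 PoszD; ring.
Qed.

Lemma iter_fdiff_fall i d : exists2 q : int, q != 0 &
  forall v, iter i (fdiff (delta_mx 0 0)) (fall (i + d)) v = q * fall d v.
Proof.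
elim: i d => [|i IHi] d; first by exists 1 => // v; rewrite mul1r.
have [q q0 qE] := IHi d.+1; exists (q * Posz d.+1) => [|v]; first by rewrite mulf_neq0.
by rewrite iterS addSnnS /fdiff !qE -mulrBr -mulrA -fdiff_fall.
Qed.

Lemma deg_lt_fall d : deg_lt d.+1 (fall d).
Proof.
elim: d => [|d IHd]; first by move=> a v; rewrite /fdiff /= subrr.
by have := deg_lt_additiveM (coordf 0) (- Posz d) IHd.
Qed.

Definition gens : set (wreath V) :=
  range (fun i : 'I_k.+1 => wfun (coordf i)) `|`
  range (fun i : 'I_k.+1 => wtrans (delta_mx 0 i)) `|` [set wfun (fall c.-1)].

Lemma finite_gens : finite_set gens.
Proof.
rewrite /gens !finite_setU; split; last exact: finite_set1.
by split; apply: finite_image; apply: finite_finset.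
Qed.

Lemma deg_gens x : gens x -> deg_lt c x.1.
Proof.
move=> [[[i _ <-]|[i _ <-]]|->] /=.
- rewrite -(subnK c_gt1); elim: (c - 2)%N => [|d IHd]; last exact: deg_ltS.
  by move=> a b v; rewrite /fdiff !raddfD /=; ring.
- exact: deg_lt0.
- by have := deg_lt_fall c.-1; rewrite prednK // (ltn_trans _ c_gt1).
Qed.

Lemma gens_coordf i : gen gens (wfun (coordf i)).
Proof. by apply: gen_base; left; left; exists i. Qed.

Lemma gens_fall : gen gens (wfun (fall c.-1)).
Proof. by apply: gen_base; right. Qed.

Lemma gens_wtrans a : gen gens (wtrans a).
Proof.
have trD u v : gen gens (wtrans u) -> gen gens (wtrans v) -> gen gens (wtrans (u + v)).
  by rewrite -wtransM; exact: gen_memM.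
have trMn u n : gen gens (wtrans u) -> gen gens (wtrans (u *+ n)).
  move=> gu; elim: n => [|n IHn]; first by rewrite mulr0n; apply: gen_mem1.
  by rewrite mulrS; apply: trD.
rewrite [a]row_sum_delta; apply: (big_ind (fun u => gen gens (wtrans u))).
- exact: gen_mem1.
- exact: trD.
move=> i _; have gi : gen gens (wtrans (delta_mx 0 i : V)).
  by apply: gen_base; left; right; exists i.
rewrite -[a 0 i]intz scaler_int; case: (a 0 i) => n; first exact: trMn.
by rewrite NegzE mulrNz -wtransV; apply: gen_memV; apply: trMn.
Qed.

Lemma coordf_separate (a : V) : (forall i, coordf i a = 0) -> a = 0.
Proof. by move=> a0; apply/rowP => i; rewrite mxE; apply: a0. Qed.

(** The image in [R] of a value of an integral polynomial depends only on the
    image of its argument, the map from Z to [R] being a ring morphism. *)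
Lemma fall_intr (R : nzRingType) d v w : (coordf 0 v)%:~R = (coordf 0 w)%:~R :> R ->
  (fall d v)%:~R = (fall d w)%:~R :> R.
Proof.
move=> vw; elim: d => [|d IHd] //=.
by rewrite !intrM IHd !intrD vw.
Qed.

Let G : groupType := genType gens.

Lemma gens_cst1 : gen gens (wfun (fun=> 1)).
Proof.
suff -> : wfun (fun=> 1) = [~ wfun (coordf 0), wtrans (delta_mx 0 0 : V)]%g.
  by apply: gen_memR; [apply: gens_coordf|apply: gens_wtrans].
rewrite commg_wtrans //; congr wfun; apply/funext => v.
by rewrite fdiff_additive /= /coordf mxE !eqxx.
Qed.

Definition coordg i : G := mkgen (gens_coordf i).
Definition transg a : G := mkgen (gens_wtrans a).
Definition central : G := mkgen gens_cst1.

Lemma central_commute (x : G) : commute central x.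
Proof.
apply: commute_sym; apply/commgP/eqP; apply: genval_inj; rewrite genvalR commg_wfun.
by apply: wreath_eq => // v /=; rewrite /fdiff subrr oppr0.
Qed.

Lemma commg_coordg i a n : coordf i a = Posz n -> [~ coordg i, transg a]%g = (central ^+ n)%g.
Proof.
move=> an; apply: genval_inj; rewrite genvalR genvalX commg_wtrans // wfunX.
by apply: wreath_eq => // v /=; rewrite fdiff_additive /= an -natz.
Qed.

(** Modulo [N] the element [coordg 0 ^+ N] is the zero function, whereas
    [central ^+ (2 ^ j)] is the constant function N/2. *)
Lemma separating_quotient j (N := (2 ^ j.+1)%N) :
  exists (Q : finGroupType) (f : {multiplicative G -> Q}),
    f (coordg 0%R ^+ N)%g = 1%g /\ f (coordg 0%R ^+ N * central ^+ (2 ^ j)) %g != 1%g.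
Proof.
have N_gt1 : (1 < N)%N by rewrite -(expn0 2) ltn_exp2l.
have j_lt : (2 ^ j < N)%N by rewrite ltn_exp2l.
pose red := map_mx intr : 'rV[int]_k.+1 -> 'rV['Z_N]_k.+1.
pose lift (u : 'rV['Z_N]_k.+1) : V := map_mx (fun r : 'Z_N => Posz r) u.
have liftK : cancel lift red by move=> u; apply/rowP => i; rewrite !mxE; apply: natr_Zp.
have coord_red i v w : red v = red w -> (coordf i v)%:~R = (coordf i w)%:~R :> 'Z_N.
  by move/rowP/(_ i); rewrite /red !mxE.
have red_gens x : gens x -> red_compatible 'Z_N red x.
  move=> [[[i _ <-]|[i _ <-]]|->] v w vw //=; first exact: coord_red.
  by apply: fall_intr; apply: coord_red.
have [Q [f fP]] := finite_quotient liftK red_gens.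
have N0 (r : 'Z_N) : r *+ N = 0 by rewrite -mulr_natr pchar_Zp // mulr0.
exists Q, f; split.
  apply/fP; rewrite genvalX wfunX // => u /=.
  by rewrite rmorphMn N0.
apply/eqP => /fP; rewrite genvalM !genvalX !wfunX wfunM /= => /(_ erefl 0).
rewrite intrD !rmorphMn /= N0 add0r => /(congr1 val)/=.
rewrite val_Zp_nat // modn_small // => /eqP; rewrite -leqn0 leqNgt expn_gt0 //.
Qed.

Lemma coordg_power_not_conjugate j :
  ~ conjugate (coordg 0%R ^+ (2 ^ j.+1))%g (coordg 0%R ^+ (2 ^ j.+1) * central ^+ (2 ^ j))%g.
Proof.
have [Q [f [fx fy]]] := separating_quotient j; case=> w xy.
by move: fy; rewrite -xy multiplicativeJ fx conj1g eqxx.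
Qed.

(** The images of [coordg 0], of the first unit translation and of [central]
    satisfy the hypotheses of [separated_order], and the translations by the
    vectors with entries below [2 ^ j.+1] those of [quotient_card_ge]. *)
Lemma CD_coordg_power j :
  ((2 ^ j.+1) ^ k.+1 <= CD (coordg 0%R ^+ (2 ^ j.+1))%g
                           (coordg 0%R ^+ (2 ^ j.+1) * central ^+ (2 ^ j))%g)%N.
Proof.
have [Q0 [f0 [fx0 fy0]]] := separating_quotient j.
apply: (CD_ge fx0 fy0) => Q f.
rewrite gmulfM !multiplicativeX => nconj.
have fcomm (x y : G) : commute x y -> commute (f x) (f y) by exact: gmulf_commute.
have comm00 : [~ coordg 0%R, transg (delta_mx 0 0)]%g = central.
  by rewrite (@commg_coordg 0%R _ 1) // /coordf mxE !eqxx.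
have dvd_order : (2 ^ j.+1 %| #[f central])%N.
  apply: (separated_order (g := f (coordg 0%R)) (u := f (transg (delta_mx 0 0)))) nconj.
  - by apply: fcomm; apply: central_commute.
  - by apply: fcomm; apply: commute_sym; apply: central_commute.
  - by rewrite -multiplicativeR comm00.
pose vec (v : {ffun 'I_k.+1 -> 'I_(2 ^ j.+1)}) : V := \row_i Posz (v i).
apply: (quotient_card_ge (g := fun i => f (coordg i))
  (tau := fun v => f (transg (vec v)))) dvd_order.
move=> i v; rewrite -multiplicativeR (@commg_coordg i _ (v i)) ?multiplicativeX //.
by rewrite /coordf mxE.
Qed.

(** The parameter [j] is chosen such that 2^j <= n < 2^(j+1), so that the
    separated elements have length at most linear in [n] while the quotients
    have order at least n^(k+1). *)
Lemma growth_le_Conj (S : set G) : finite_set S -> generates S ->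
  growth_le (fun n => n ^ k.+1)%N (Conj S).
Proof.
move=> finS genS.
pose L := word_length S (coordg 0%R); pose L' := word_length S central.
exists (2 * (L + L')).+1; split=> // n n_gt0.
set C := (2 * (L + L')).+1.
pose j := trunc_log 2 n; pose N := (2 ^ j.+1)%N.
have le_jn : (2 ^ j <= n)%N by exact: trunc_logP.
have lt_nN : (n < N)%N by exact: trunc_log_ltn.
have le_N : (N <= 2 * n)%N by rewrite /N expnS leq_pmul2l.
have le_x : (word_length S (coordg 0%R ^+ N)%g <= N * L)%N by exact: word_lengthX.
have le_z : (word_length S (central ^+ (2 ^ j))%g <= 2 ^ j * L')%N by exact: word_lengthX.
have le_y := word_lengthM genS (coordg 0%R ^+ N)%g (central ^+ (2 ^ j))%g.
have le_NL : (N * L <= 2 * n * L)%N by rewrite leq_mul2r le_N orbT.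
have le_jL : (2 ^ j * L' <= n * L')%N by rewrite leq_mul2r le_jn orbT.
have CE : (C * n = 2 * n * L + 2 * n * L' + n)%N by rewrite /C; ring.
apply: (@leq_trans (Conj S (C * n))); last exact: leq_pmull.
apply: (@leq_trans (N ^ k.+1)); first by rewrite leq_exp2r // ltnW.
apply: leq_trans (CD_coordg_power j) _.
apply: CD_le_Conj => //.
- exact: coordg_power_not_conjugate.
- by rewrite (leq_trans le_x) // CE (leq_trans le_NL) // -addnA leq_addr.
- rewrite (leq_trans le_y) // (leq_trans (leq_add le_x le_z)) //.
  rewrite (leq_trans (leq_add le_NL le_jL)) // CE -addnA leq_add2l.
  by rewrite -mulnA mul2n -addnn -addnA leq_addr.
Qed.

Lemma gens_step_length : has_step_length G c.
Proof.
apply: (genType_step_length deg_gens (ltnW c_gt1) (gens_wtrans (delta_mx 0 0)) gens_fall).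
have [q q0 qE] := iter_fdiff_fall c.-1 0; exists 0.
by move: qE; rewrite addn0 => ->; rewrite mulr1; apply/eqP.
Qed.

Lemma gens_torsion_free : torsion_free G.
Proof.
move=> x n n_gt0 xn1; apply: genval_inj.
apply: (wreath_torsion_free _ n_gt0); last by rewrite -genvalX xn1.
move=> a m m_gt0 am0; apply/rowP => i; have /rowP/(_ i) := am0.
by rewrite mulmxnE mxE => /eqP; rewrite mulrn_eq0 eqn0Ngt m_gt0 => /eqP.
Qed.

End Construction.

Close Scope group_scope.
Close Scope classical_set_scope.

Theorem theorem1p10 (c k : nat) (hc : 1 < c) (hk : 1 <= k) :
  exists G : groupType,
    irreducible G /\ torsion_free G /\ finitely_generated G /\
    nilpotent G /\ has_step_length G c /\
    forall S : set G, finite_set S -> generates S ->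
      growth_le (fun n => n ^ k) (Conj S).
Proof.
case: k hk => // k _.
have deg_c : forall x, @gens c k x -> deg_lt c x.1 by exact: deg_gens.
exists (genType (@gens c k)); split; [|split; [|split; [|split; [|split]]]].
- exact: (genType_irreducible deg_c (@gens_wtrans c k) (@gens_coordf c k) (@coordf_separate k)).
- exact: gens_torsion_free.
- exact: genType_fg (@finite_gens c k).
- exact: (genType_nilpotent deg_c (ltnW hc)).
- exact: gens_step_length.
- exact: growth_le_Conj.
Qed.
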